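(* Let $M$ be a 7-dimensional manifold with a nearly parallel $G_2$ structure $\varphi$, let $\xi$ be a unit vector field on $M$, and let $(\phi,\xi,\eta,g)$ be the almost contact metric structure obtained from $\varphi$ and $\xi$, with fundamental 2-form $\Phi$. If $\nabla_\xi\xi\neq 0$ (i.e. $\nabla_\xi\xi$ is not identically zero), then $\nabla\Phi$ does not belong to any of the classes $\mathcal{D}_1$, $\mathcal{D}_2$, $\mathcal{C}_{12}$.
   Context: **$G_2$ structures.** On $\mathbb{R}^7$ with dual basis $e^1,\dots,e^7$ put $\varphi_0=e^{123}+e^{145}+e^{167}+e^{246}-e^{257}-e^{347}-e^{356}$, where $e^{ijk}=e^i\wedge e^j\wedge e^k$. A $G_2$ structure on an oriented 7-manifold $M$ is a global 3-form $\varphi$ such that for each $p\in M$ there is a linear isomorphism $T_pM\cong\mathbb{R}^7$ carrying $\varphi_p$ to $\varphi_0$. It determines a Riemannian metric $g$ and an orientation (those of $\mathbb{R}^7$ under such isomorphisms) and a 2-fold vector cross product $\times$ defined by $\varphi(x,y,z)=g(x\times y,z)$. $\nabla$ is the Levi-Civita connection of $g$. The $G_2$ structure is nearly parallel if $d\varphi=k\ast\varphi$ for some constant $k$, with $\ast$ the Hodge star. **Induced almost contact metric structure.** For a unit vector field $\xi$ on $M$ put $\phi(x)=\xi\times x$, $\eta(x)=g(\xi,x)$. Then $(\phi,\xi,\eta,g)$ is an almost contact metric structure: $\phi^2=-I+\eta\otimes\xi$, $\eta(\xi)=1$, $g(\phi x,\phi y)=g(x,y)-\eta(x)\eta(y)$.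 Its fundamental 2-form is $\Phi(x,y)=g(x,\phi y)$, and $\nabla\Phi$ is regarded as the $(0,3)$-tensor $(x,y,z)\mapsto(\nabla_x\Phi)(y,z)$. **Classes (Chinea–Gonzalez).** At each $p\in M$ let $\mathcal{C}$ be the space of trilinear forms $\alpha$ on $T_pM$ with $\alpha(x,y,z)=-\alpha(x,z,y)=-\alpha(x,\phi y,\phi z)+\eta(y)\alpha(x,\xi,z)+\eta(z)\alpha(x,y,\xi)$ for all $x,y,z$; then $(\nabla\Phi)_p\in\mathcal{C}$. With identities holding for all $x,y,z\in T_pM$: - $\mathcal{D}_1=\{\alpha\in\mathcal{C}:\alpha(\xi,x,y)=\alpha(x,\xi,y)=0\}$. - $\mathcal{D}_2=\{\alpha\in\mathcal{C}:\alpha(x,y,z)=\eta(x)\alpha(\xi,y,z)+\eta(y)\alpha(x,\xi,z)+\eta(z)\alpha(x,y,\xi)\}$. - $\mathcal{C}_{12}=\{\alpha\in\mathcal{C}:\alpha(x,y,z)=\eta(x)\eta(y)\alpha(\xi,\xi,z)+\eta(x)\eta(z)\alpha(\xi,y,\xi)\}$. $\nabla\Phi$ belongs to the class given by one of these subspaces if $(\nabla\Phi)_p$ lies in that subspace for every $p\in M$. *)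

(* Defs.v *)
(* MathComp-Analysis, over an arbitrary R : realType. *)
From HB Require Import structures.
From mathcomp Require Import all_boot all_order all_algebra.
From mathcomp Require Import all_classical all_reals all_analysis.

Set Implicit Arguments.
Unset Strict Implicit.
Unset Printing Implicit Defensive.
Import Order.TTheory GRing.Theory Num.Theory.
Import numFieldNormedType.Exports.

Local Open Scope classical_set_scope.
Local Open Scope ring_scope.

(* For open U: C^0 is continuity; C^(k+1) is differentiability with all
   directional derivatives of class C^k. *)
Fixpoint class_Ck (k : nat) (R : realType) (n : nat) (W : normedModType R)
    (U : set 'rV[R]_n) (f : 'rV[R]_n -> W) : Prop :=
  match k with
  | 0 => forall u, U u -> {for u, continuous f}
  | k'.+1 => (forall u, U u -> differentiable f u) /\
             (forall v, class_Ck k' U (fun u => 'D_v f u))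
  end.

Definition smooth_on (R : realType) (n : nat) (W : normedModType R)
    (U : set 'rV[R]_n) (f : 'rV[R]_n -> W) : Prop :=
  forall k, class_Ck k U f.

(* [coord c] is a homeomorphism from the open set [domain c] of M onto an open
   set of R^n, with inverse [param c]; the values of [coord c] and [param c]
   outside these two sets are irrelevant. *)
Record smooth_atlas (R : realType) (n : nat) (M : topologicalType) :=
  SmoothAtlas {
    chart :> Type;
    domain : chart -> set M;
    coord : chart -> M -> 'rV[R]_n;
    param : chart -> 'rV[R]_n -> M;
    domain_open : forall c, open (domain c);
    domain_cover : forall p, exists c, domain c p;
    image_open : forall c, open (coord c @` domain c);
    coordK : forall c p, domain c p -> param c (coord c p) = p;
    coord_continuous : forall c p, domain c p -> {for p, continuous (coord c)};
    param_continuous : forall c u, (coord c @` domain c) u ->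
      {for u, continuous (param c)};
    transition_smooth : forall c d,
      smooth_on (coord c @` (domain c `&` domain d)) (coord d \o param c)
  }.

Section Fields.
Variables (R : realType) (n : nat) (M : topologicalType).
Variable S : smooth_atlas R n M.
Local Notation V := 'rV[R]_n.

Definition chart_image (c : S) : set V := coord c @` domain c.

Definition overlap (c d : S) : set V := coord c @` (domain c `&` domain d).

Definition transition (c d : S) : V -> V := coord d \o param c.

(* A field on M is given by its expression in every chart c, as a function of
   u in [chart_image c]: the chart identifies the tangent space at
   [param c u] with R^n.  Only values on [chart_image c] are meaningful.  The
   differential 'D_x (transition c d) u carries the vector x in the chart c
   to its expression in the chart d. *)
Definition vector_field (X : S -> V -> V) : Prop :=
  (forall c, smooth_on (chart_image c) (X c)) /\
  (forall c d u, overlap c d u ->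
     X d (transition c d u) = 'D_(X c u) (transition c d) u).

Definition tensor2_field (T : S -> V -> V -> V -> R) : Prop :=
  [/\ forall c u, chart_image c u ->
        (forall y, scalar (T c u ^~ y)) /\ (forall x, scalar (T c u x)),
      forall c x y, smooth_on (chart_image c) (fun u => T c u x y)
    & forall c d u, overlap c d u -> forall x y,
        T d (transition c d u) ('D_x (transition c d) u)
          ('D_y (transition c d) u) = T c u x y].

Definition trilinear (a : V -> V -> V -> R) : Prop :=
  [/\ forall y z, scalar (fun x => a x y z),
      forall x z, scalar (fun y => a x y z)
    & forall x y, scalar (fun z => a x y z)].

Definition alternating (a : V -> V -> V -> R) : Prop :=
  forall x y, [/\ a x x y = 0, a x y y = 0 & a x y x = 0].

Definition differential_3form (w : S -> V -> V -> V -> V -> R) : Prop :=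
  [/\ forall c u, chart_image c u -> trilinear (w c u) /\ alternating (w c u),
      forall c x y z, smooth_on (chart_image c) (fun u => w c u x y z)
    & forall c d u, overlap c d u -> forall x y z,
        w d (transition c d u) ('D_x (transition c d) u)
          ('D_y (transition c d) u) ('D_z (transition c d) u) = w c u x y z].

Definition riemannian_metric (g : S -> V -> V -> V -> R) : Prop :=
  tensor2_field g /\
  (forall c u, chart_image c u ->
     (forall x y, g c u x y = g c u y x) /\
     (forall x, x != 0 -> 0 < g c u x x)).

(* No factor 1/4: evaluated on constant vector fields of the chart, matching
   (e^i /\ e^j /\ e^k)(e_i, e_j, e_k) = 1. *)
Definition exterior_derivative (w : S -> V -> V -> V -> V -> R)
    (c : S) (u x y z t : V) : R :=
  'D_x (fun v => w c v y z t) u - 'D_y (fun v => w c v x z t) u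
  + 'D_z (fun v => w c v x y t) u - 'D_t (fun v => w c v x y z) u.

(* [G c u x y] is the Christoffel term of the connection in the chart c, i.e.
   the covariant derivative, in the direction x, of the vector field with
   constant coordinates y.  The last condition says that covariant derivatives
   do not depend on the chart. *)
Definition affine_connection (G : S -> V -> V -> V -> V) : Prop :=
  [/\ forall c u, chart_image c u ->
        (forall y, linear (G c u ^~ y)) /\ (forall x, linear (G c u x)),
      forall c x y, smooth_on (chart_image c) (fun u => G c u x y)
    & forall c d u, overlap c d u -> forall x y,
        'D_(G c u x y) (transition c d) u =
          'D_x (fun v => 'D_y (transition c d) v) u
          + G d (transition c d u) ('D_x (transition c d) u)
              ('D_y (transition c d) u)].

Definition nabla_vector (G : S -> V -> V -> V -> V) (X : S -> V -> V)
    (c : S) (u x : V) : V :=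
  'D_x (X c) u + G c u x (X c u).

Definition nabla_tensor2 (G : S -> V -> V -> V -> V)
    (T : S -> V -> V -> V -> R) (c : S) (u x y z : V) : R :=
  'D_x (fun v => T c v y z) u - T c u (G c u x y) z - T c u y (G c u x z).

Definition levi_civita (g : S -> V -> V -> V -> R)
    (G : S -> V -> V -> V -> V) : Prop :=
  [/\ affine_connection G,
      forall c u, chart_image c u -> forall x y, G c u x y = G c u y x
    & forall c u, chart_image c u -> forall x y z, nabla_tensor2 G g c u x y z = 0].

End Fields.

Section G2.
Variable R : realType.
Local Notation V := 'rV[R]_7.

(* The coordinate function e^i, for 1 <= i <= 7. *)
Definition dual_basis (i : nat) (x : V) : R := x 0 (inord i.-1).

(* e^i /\ e^j /\ e^k, with the determinant convention. *)
Definition wedge3 (i j k : nat) (x y z : V) : R :=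
  let e := dual_basis in
    e i x * (e j y * e k z - e k y * e j z)
  - e j x * (e i y * e k z - e k y * e i z)
  + e k x * (e i y * e j z - e j y * e i z).

Definition phi0 (x y z : V) : R :=
  wedge3 1 2 3 x y z + wedge3 1 4 5 x y z + wedge3 1 6 7 x y z
  + wedge3 2 4 6 x y z - wedge3 2 5 7 x y z - wedge3 3 4 7 x y z
  - wedge3 3 5 6 x y z.

(* The rows of B form a basis of the tangent space, and the isomorphism
   a |-> a *m B from R^7 to the tangent space carries phi0 to phi. *)
Definition g2_frame (phi : V -> V -> V -> R) (B : 'M[R]_7) : Prop :=
  B \in unitmx /\
  (forall a b c : V, phi (a *m B) (b *m B) (c *m B) = phi0 a b c).

Definition g2_inner_product (phi : V -> V -> V -> R) (g : V -> V -> R) : Prop :=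
  forall B, g2_frame phi B ->
    forall a b : V, g (a *m B) (b *m B) = \sum_i a 0 i * b 0 i.

(* The rows of B form a positive basis for the orientation given by phi. *)
Definition g2_positive (phi : V -> V -> V -> R) (B : 'M[R]_7) : Prop :=
  exists B0, g2_frame phi B0 /\ 0 < \det B0 * \det B.

Definition orthonormal_basis (g : V -> V -> R) (B : 'M[R]_7) : Prop :=
  forall i j, g (row i B) (row j B) = (i == j)%:R.

(* For a positive orthonormal basis B, the Riemannian volume form evaluated on
   the first seven vectors of s. *)
Definition volume (B : 'M[R]_7) (s : seq V) : R :=
  \det ((\matrix_(i < 7) s`_i) *m invmx B).

(* w is the Hodge star of the 3-form a, with respect to the inner product g and
   to the orientation whose positive bases are given by pos:
     *a = 1/3! \sum_(i, j, k) a(b_i, b_j, b_k) vol(b_i, b_j, b_k, -, -, -, -)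
   for every positive orthonormal basis b (the right-hand side is independent
   of b), so that a /\ *a = |a|^2 vol. *)
Definition hodge_star3 (g : V -> V -> R) (pos : 'M[R]_7 -> Prop)
    (a : V -> V -> V -> R) (w : V -> V -> V -> V -> R) : Prop :=
  forall B, orthonormal_basis g B -> pos B -> forall x y z t,
    w x y z t = 6%:R^-1 * \sum_(i < 7) \sum_(j < 7) \sum_(k < 7)
      a (row i B) (row j B) (row k B) *
      volume B [:: row i B; row j B; row k B; x; y; z; t].

Definition cross_product (phi : V -> V -> V -> R) (g : V -> V -> R)
    (cr : V -> V -> V) : Prop :=
  forall x y z, phi x y z = g (cr x y) z.

(* The classes of an almost contact metric structure (J, xi, eta) on a tangent
   space. *)
Definition classC (J : V -> V) (xi : V) (eta : V -> R) :
    set (V -> V -> V -> R) :=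
  [set a | trilinear a /\ forall x y z,
     a x y z = - a x z y /\
     a x y z = - a x (J y) (J z) + eta y * a x xi z + eta z * a x y xi].

Definition classD1 (J : V -> V) (xi : V) (eta : V -> R) :
    set (V -> V -> V -> R) :=
  [set a | classC J xi eta a /\
     forall x y, a xi x y = 0 /\ a x xi y = 0].

Definition classD2 (J : V -> V) (xi : V) (eta : V -> R) :
    set (V -> V -> V -> R) :=
  [set a | classC J xi eta a /\ forall x y z,
     a x y z = eta x * a xi y z + eta y * a x xi z + eta z * a x y xi].

Definition classC12 (J : V -> V) (xi : V) (eta : V -> R) :
    set (V -> V -> V -> R) :=
  [set a | classC J xi eta a /\ forall x y z,
     a x y z = eta x * eta y * a xi xi z + eta x * eta z * a xi y xi].

End G2.

Section G2Structure.
Variables (R : realType) (M : topologicalType) (S : smooth_atlas R 7 M).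
Local Notation V := 'rV[R]_7.

Definition g2_structure (phi : S -> V -> V -> V -> V -> R) : Prop :=
  differential_3form phi /\
  (forall c u, chart_image c u -> exists B, g2_frame (phi c u) B).

Definition g2_metric (phi : S -> V -> V -> V -> V -> R)
    (g : S -> V -> V -> V -> R) : Prop :=
  riemannian_metric g /\
  (forall c u, chart_image c u -> g2_inner_product (phi c u) (g c u)).

Definition nearly_parallel (phi : S -> V -> V -> V -> V -> R)
    (g : S -> V -> V -> V -> R) : Prop :=
  exists k : R, forall c u, chart_image c u ->
    exists2 psi, hodge_star3 (g c u) (g2_positive (phi c u)) (phi c u) psi
      & forall x y z t, exterior_derivative phi c u x y z t = k * psi x y z t.

Definition induced_endomorphism (cr : S -> V -> V -> V -> V) (xi : S -> V -> V)
    (c : S) (u x : V) : V := cr c u (xi c u) x.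

Definition induced_1form (g : S -> V -> V -> V -> R) (xi : S -> V -> V)
    (c : S) (u x : V) : R := g c u (xi c u) x.

Definition fundamental_2form (g : S -> V -> V -> V -> R)
    (J : S -> V -> V -> V) (c : S) (u x y : V) : R :=
  g c u x (J c u y).

Definition belongs_to
    (K : (V -> V) -> V -> (V -> R) -> set (V -> V -> V -> R))
    (J : S -> V -> V -> V) (xi : S -> V -> V) (eta : S -> V -> V -> R)
    (a : S -> V -> V -> V -> V -> R) : Prop :=
  forall c u, chart_image c u -> K (J c u) (xi c u) (eta c u) (a c u).

End G2Structure.

(* Main.v *)
Require Import Defs.
From HB Require Import structures.
From mathcomp Require Import all_boot all_order all_algebra.
From mathcomp Require Import all_classical all_reals all_analysis.
From mathcomp Require Import perm ring lra.

(** Write [b_x] for the 3-form nabla_x phi and [v] for nabla_xi xi.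
Differentiating Phi(y, z) = phi(xi, z, y) gives
  (nabla_x Phi)(y, z) = b_x(xi, z, y) + phi(nabla_x xi, z, y)
([nabla_fundamental_form]), and nabla_x xi is orthogonal to the unit field xi
([nabla_vec_orthogonal]).  Put x = y = xi: the first term vanishes and what
is left is (nabla_xi Phi)(xi, z) = phi(v, z, xi).  Both D1 and D2 force this to
vanish, so v x xi = 0, and v = 0 because v is orthogonal to xi
([orthogonal_cross_eq0]).

In the class C12 the form (nabla_x Phi) vanishes for x orthogonal to xi.  The
previous argument then gives nabla_x xi = 0 for such x, hence b_x(xi, ., .) = 0.
For x = xi, it gives b_xi(xi, y, z) = - phi(v, y, z) on vectors y, z orthogonal
to xi.  Three facts turn this into v = 0, at a single point.
 - The connection is torsion free, so d phi is the alternation of nabla phi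
   ([exterior_derivative_nabla_form3]); the equation d phi = k * phi therefore
   reads b_xi(x, y, z) = k ( * phi)(xi, x, y, z) on vectors orthogonal to xi.
 - b_w(y, z, y x z) = 0 for all w, y, z ([nabla_form3_cross]): this is the
   derivative of the identity |y x z|^2 = |y|^2 |z|^2 - <y, z>^2, i.e. b_w is
   tangent to the orbit of G2 forms having a given metric.
 - ( * phi)(p, q, p x q, u) = 0 for orthonormal p, q and u orthogonal to
   p, q, p x q ([hodge_star_associative_plane]).
Choose a unit vector q orthogonal to xi, v and xi x v.  Polarizing the second
fact gives b_xi(q, xi x q, v) = |v|^2, while the first and the third make this
number vanish ([nearly_parallel_obstruction]).

For k <> 0 one can show that b_x = (k / 4) ( * phi)(x, ., ., .), but for k = 0
the equation d phi = 0 does not make phi parallel.  The argument above uses only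
what is common to both cases. *)

Set Implicit Arguments.
Unset Strict Implicit.
Unset Printing Implicit Defensive.
Import Order.TTheory GRing.Theory Num.Theory.
Import numFieldNormedType.Exports.

Local Open Scope classical_set_scope.
Local Open Scope ring_scope.

(** * Multilinear forms *)

Section ScalarForms.
Variables (R : realType) (V : lmodType R) (f : V -> R).
Hypothesis f_lin : scalar f.

Lemma scalarD x y : f (x + y) = f x + f y.
Proof. by have := f_lin 1 x y; rewrite scale1r mul1r. Qed.

Lemma scalar0 : f 0 = 0.
Proof. by apply: (addrI (f 0)); rewrite -scalarD !addr0. Qed.

Lemma scalarZ a x : f (a *: x) = a * f x.
Proof. by have := f_lin a x 0; rewrite !addr0 scalar0 addr0. Qed.

Lemma scalarN x : f (- x) = - f x.
Proof. by rewrite -scaleN1r scalarZ mulN1r. Qed.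

Lemma scalar_sum (I : Type) (s : seq I) (F : I -> V) :
  f (\sum_(i <- s) F i) = \sum_(i <- s) f (F i).
Proof.
elim: s => [|i s IHs]; first by rewrite !big_nil scalar0.
by rewrite !big_cons scalarD IHs.
Qed.

End ScalarForms.

Section Alternation.
Variables (R : realType) (n : nat).
Local Notation V := 'rV[R]_n.
Variable a : V -> V -> V -> R.
Hypotheses (a_lin : trilinear a) (a_alt : Defs.alternating a).

Lemma trilinearDl x x' y z : a (x + x') y z = a x y z + a x' y z.
Proof. by have [H _ _] := a_lin; rewrite (scalarD (H y z)). Qed.

Lemma trilinearDm x y y' z : a x (y + y') z = a x y z + a x y' z.
Proof. by have [_ H _] := a_lin; rewrite (scalarD (H x z)). Qed.

Lemma trilinearDr x y z z' : a x y (z + z') = a x y z + a x y z'.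
Proof. by have [_ _ H] := a_lin; rewrite (scalarD (H x y)). Qed.

Lemma alternating_swapl x y z : a x y z = - a y x z.
Proof.
have [/eqP] := a_alt (x + y) z.
rewrite trilinearDl !trilinearDm.
by have [-> _ _] := a_alt x z; have [-> _ _] := a_alt y z; lra.
Qed.

Lemma alternating_swapr x y z : a x y z = - a x z y.
Proof.
have [_ /eqP + _] := a_alt x (y + z).
rewrite trilinearDm !trilinearDr.
by have [_ -> _] := a_alt x y; have [_ -> _] := a_alt x z; lra.
Qed.

Lemma alternating_rot x y z : a x y z = a y z x.
Proof. by rewrite alternating_swapl alternating_swapr opprK. Qed.

End Alternation.

(** * Inner product spaces with a vector cross product *)

(** The last field says that the product
(a, x) (b, y) = (a b - <x, y>, a y + b x + x x y) makes R + V a composition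
algebra. *)
Record cross_algebra (R : realType) (n : nat)
    (phi : 'rV[R]_n -> 'rV[R]_n -> 'rV[R]_n -> R)
    (g : 'rV[R]_n -> 'rV[R]_n -> R)
    (cr : 'rV[R]_n -> 'rV[R]_n -> 'rV[R]_n) : Prop := CrossAlgebra {
  phi_trilinear : trilinear phi;
  phi_alternating : Defs.alternating phi;
  dot_scalar : forall x, scalar (g x);
  dotC : forall x y, g x y = g y x;
  dot_gt0 : forall x, x != 0 -> 0 < g x x;
  dot_cross : forall x y z, g (cr x y) z = phi x y z;
  dot_cross_cross : forall x y,
    g (cr x y) (cr x y) = g x x * g y y - g x y ^+ 2
}.

Section CrossAlgebraTheory.
Variables (R : realType) (n : nat).
Local Notation V := 'rV[R]_n.
Variables (phi : V -> V -> V -> R) (g : V -> V -> R) (cr : V -> V -> V).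
Hypothesis H : cross_algebra phi g cr.

Lemma dotDr x y z : g x (y + z) = g x y + g x z.
Proof. exact: scalarD (dot_scalar H x) _ _. Qed.
Lemma dotZr x a y : g x (a *: y) = a * g x y.
Proof. exact: scalarZ (dot_scalar H x) _ _. Qed.
Lemma dotNr x y : g x (- y) = - g x y.
Proof. exact: scalarN (dot_scalar H x) _. Qed.
Lemma dotDl x y z : g (x + y) z = g x z + g y z.
Proof. by rewrite !(dotC H _ z) dotDr. Qed.
Lemma dotZl x a y : g (a *: x) y = a * g x y.
Proof. by rewrite !(dotC H _ y) dotZr. Qed.
Lemma dotNl x y : g (- x) y = - g x y.
Proof. by rewrite !(dotC H _ y) dotNr. Qed.
Lemma dot0l y : g 0 y = 0.
Proof. by rewrite (dotC H) (scalar0 (dot_scalar H y)). Qed.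

Definition dotE := (dotDr, dotDl, dotZr, dotZl, dotNr, dotNl).

Lemma dot_eq0 x : (g x x == 0) = (x == 0).
Proof.
apply/eqP/eqP => [|->]; last exact: scalar0 (dot_scalar H 0).
by move=> gx; apply/eqP/negPn/negP => /(dot_gt0 H); rewrite gx ltxx.
Qed.

Lemma dot_inj x y : (forall z, g x z = g y z) -> x = y.
Proof.
move=> exy; apply/eqP; rewrite -subr_eq0 -dot_eq0.
by rewrite dotDl dotNl exy subrr.
Qed.

Lemma cauchy_schwarz x y : g x y ^+ 2 <= g x x * g y y.
Proof.
have [->|x0] := eqVneq x 0.
  by rewrite !dot0l mul0r expr0n.
have gx := dot_gt0 H x0; rewrite -subr_ge0.
set w := g x x *: y - g x y *: x.
have <- : g w w / g x x = g x x * g y y - g x y ^+ 2.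
  by rewrite /w !dotE (dotC H y x); field; apply: lt0r_neq0.
have [->|w0] := eqVneq w 0; last by rewrite ltW // divr_gt0 // (dot_gt0 H).
by rewrite dot0l mul0r.
Qed.

Let phiT := phi_trilinear H.
Let phiA := phi_alternating H.

Lemma crossDr x y z : cr x (y + z) = cr x y + cr x z.
Proof.
apply: dot_inj => w; rewrite dotDl !(dot_cross H).
exact: trilinearDm phiT _ _ _ _.
Qed.

Lemma crossC x y : cr x y = - cr y x.
Proof.
apply: dot_inj => w; rewrite dotNl !(dot_cross H).
exact: alternating_swapl phiT phiA _ _ _.
Qed.

Lemma crossDl x y z : cr (x + y) z = cr x z + cr y z.
Proof. by rewrite !(crossC _ z) crossDr opprD. Qed.

Lemma crossNr x y : cr x (- y) = - cr x y.
Proof.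
apply: dot_inj => w; rewrite dotNl !(dot_cross H).
have [_ L _] := phiT; exact: scalarN (L x w) _.
Qed.

Lemma crossZr x a y : cr x (a *: y) = a *: cr x y.
Proof.
apply: dot_inj => w; rewrite dotZl !(dot_cross H).
have [_ L _] := phiT; exact: scalarZ (L x w) _ _.
Qed.

Lemma crossxx x : cr x x = 0.
Proof.
apply: dot_inj => w; rewrite dot0l (dot_cross H).
by have [-> _ _] := phiA x w.
Qed.

Lemma dot_crossl x y : g x (cr x y) = 0.
Proof. by rewrite (dotC H) (dot_cross H); have [_ _ ->] := phiA x y. Qed.

Lemma dot_crossr x y : g x (cr y x) = 0.
Proof. by rewrite crossC dotNr dot_crossl oppr0. Qed.

Lemma dot_cross_cross2 x y z :
  g (cr x y) (cr x z) = g x x * g y z - g x y * g x z.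
Proof.
have := dot_cross_cross H x (y + z).
rewrite !crossDr !dotE !(dot_cross_cross H) (dotC H (cr x z)) (dotC H z y).
lra.
Qed.

Lemma cross_crossl x z : cr x (cr x z) = g x z *: x - g x x *: z.
Proof.
apply: dot_inj => w; rewrite !dotE (dot_cross H).
rewrite (alternating_swapr phiT phiA) -(dot_cross H) dot_cross_cross2.
by rewrite (dotC H w z); ring.
Qed.

(** Polarization of [cross_crossl] in its first argument: on orthogonal
vectors, left cross products anticommute. *)
Lemma cross_cross_anti x y z : g x y = 0 -> g x z = 0 -> g y z = 0 ->
  cr x (cr y z) = - cr y (cr x z).
Proof.
move=> xy xz yz; apply: dot_inj => w.
have := congr1 (g ^~ w) (cross_crossl (x + y) z).
rewrite /= !crossDl !crossDr !cross_crossl !dotE (dotC H y x) xy xz yz.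
lra.
Qed.

Lemma dot_crossC x y z : g (cr x y) z = - g (cr x z) y.
Proof. by rewrite !(dot_cross H) (alternating_swapr phiT phiA). Qed.

Lemma orthogonal_cross_eq0 xi w :
  g xi xi = 1 -> g xi w = 0 -> (forall z, phi w z xi = 0) -> w = 0.
Proof.
move=> xi1 xiw phi0; apply/eqP; rewrite -dot_eq0; apply/eqP.
have := dot_cross_cross H xi w; rewrite xi1 xiw mul1r expr0n subr0 => <-.
by rewrite (dot_cross H) (alternating_rot phiT phiA).
Qed.

(** (p x u) x (q x u) = - |u|^2 p x q, moving q to the left past p x u, and p x q is
orthogonal to (p x q) x u.  Geometrically, the orthogonal complement of an
associative 3-plane is coassociative. *)
Lemma coassociative_plane p q u :
  g p q = 0 -> g p u = 0 -> g q u = 0 -> g (cr p q) u = 0 ->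
  phi (cr p u) (cr q u) (cr (cr p q) u) = 0.
Proof.
move=> pq pu qu ru.
rewrite -(dot_cross H) (@cross_cross_anti (cr p u) q u) //; last first.
- by rewrite (dotC H) dot_crossr.
- by rewrite dot_crossC ru oppr0.
have -> : cr (cr p u) u = - (g u u *: p).
  by rewrite crossC (crossC p u) crossNr opprK cross_crossl (dotC H u p) pu
    scale0r sub0r.
rewrite crossNr opprK crossZr dotZl (crossC q).
by rewrite dotNl dot_crossl oppr0 mulr0.
Qed.

End CrossAlgebraTheory.

(** * The Hodge star of phi on an associative plane *)

Section VolumeAndStar.
Variable R : realType.
Local Notation V := 'rV[R]_7.

Lemma volume_repeated (B : 'M[R]_7) (s : seq V) (i j : 'I_7) :
  i != j -> s`_i = s`_j -> volume B s = 0.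
Proof.
move=> ij sij; apply: (determinant_alternate ij) => k; rewrite !mxE.
by apply: eq_bigr => l _; rewrite !mxE sij.
Qed.

Variables (phi : V -> V -> V -> R) (g : V -> V -> R) (cr : V -> V -> V).
Hypothesis H : cross_algebra phi g cr.

Lemma orthonormal_unitmx (B : 'M[R]_7) :
  orthonormal_basis g B -> B \in unitmx.
Proof.
move=> ortB.
(* The Gram matrix of the rows exhibits a right inverse of B. *)
suff /mulmx1_unit[] : B *m (\matrix_(j, k) g (row k B) (delta_mx 0 j)) = 1%:M.
  by [].
apply/matrixP => i k; rewrite !mxE -ortB.
rewrite [in RHS](row_sum_delta (row i B)) (dotC H).
rewrite (scalar_sum (dot_scalar H _)); apply: eq_bigr => j _.
by rewrite (dotZr H) !mxE.
Qed.

(** Exchanging two rows corrects the sign of the determinant. *)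
Lemma positive_row_perm (B0 B : 'M[R]_7) :
  g2_frame phi B0 -> orthonormal_basis g B ->
  exists s : 'S_7, g2_positive phi (row_perm s B).
Proof.
move=> frB0 /orthonormal_unitmx.
rewrite unitmxE unitfE => detB.
have detB0 : \det B0 != 0 by have [+ _] := frB0; rewrite unitmxE unitfE.
have := mulf_neq0 detB0 detB; rewrite neq_lt => /orP[neg|pos].
  exists (tperm 0 1), B0; split => //.
  rewrite row_permE det_mulmx det_perm odd_tperm /= expr1 mulN1r mulrN.
  by rewrite oppr_gt0.
by exists 1%g, B0; rewrite row_permE perm_mx1 mul1mx.
Qed.

Lemma orthonormal_row_perm (s : 'S_7) (B : 'M[R]_7) :
  orthonormal_basis g B -> orthonormal_basis g (row_perm s B).
Proof.
by move=> ortB i j; rewrite !row_permEsub !row_rowsub ortB (inj_eq perm_inj).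
Qed.

Variables (p q u : V).
Hypotheses (pp : g p p = 1) (qq : g q q = 1) (uu : g u u = 1).
Hypotheses (pq : g p q = 0) (pu : g p u = 0) (qu : g q u = 0).
Hypothesis (ru : g (cr p q) u = 0).

(** The quaternionic basis of the associative plane of p and q, then u, then
the images of the former under - x u, which is an isometry of the orthogonal
complement of the unit vector u. *)
Definition adapted_rows : seq V :=
  [:: p; q; cr p q; u; cr p u; cr q u; cr (cr p q) u].

Definition adapted_basis : 'M[R]_7 := \matrix_(i < 7) adapted_rows`_i.

Lemma adapted_basis_orthonormal : orthonormal_basis g adapted_basis.
Proof.
have gC := dotC H.
have rr : g (cr p q) (cr p q) = 1.
  by rewrite (dot_cross_cross H) pp qq pq expr0n mul1r subr0.
have pr : g p (cr p q) = 0 by rewrite (dot_crossl H).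
have qr : g q (cr p q) = 0 by rewrite (dot_crossr H).
have prE : cr p (cr p q) = - q.
  by rewrite (cross_crossl H) pp pq scale0r scale1r sub0r.
have qrE : cr q (cr p q) = p.
  by rewrite (crossC H p) (crossNr H) (cross_crossl H) qq gC pq scale0r sub0r
    scale1r opprK.
(* Since <x x u, y> = - <x x y, u>, the inner products of a row x u of the last
   block with the first block reduce to products inside the associative plane. *)
have sh x y : g (cr x u) y = - g (cr x y) u by rewrite (dot_crossC H).
have sh' x y : g y (cr x u) = - g (cr x y) u by rewrite gC sh.
have iso x y : g x u = 0 -> g y u = 0 -> g (cr x u) (cr y u) = g x y.
  move=> xu yu; rewrite (crossC H x) (crossC H y) (dotNl H) (dotNr H) opprK.
  by rewrite (dot_cross_cross2 H) uu (gC u x) xu mul0r subr0 mul1r.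
have rpE : cr (cr p q) p = q by rewrite (crossC H) prE opprK.
have rqE : cr (cr p q) q = - p by rewrite (crossC H) qrE.
have qpE : cr q p = - cr p q by rewrite (crossC H).
pose t := nth 0 [:: p; q; cr p q].
have tt a b : (a < 3)%N -> (b < 3)%N -> g (t a) (t b) = (a == b)%:R.
  case: a b => [|[|[|//]]] [|[|[|//]]] _ _ /=.
  - exact: pp.
  - exact: pq.
  - exact: pr.
  - by rewrite gC pq.
  - exact: qq.
  - exact: qr.
  - by rewrite gC pr.
  - by rewrite gC qr.
  - exact: rr.
have tu a : (a < 3)%N -> g (t a) u = 0 by case: a => [|[|[|//]]].
have ttu a b : (a < 3)%N -> (b < 3)%N -> g (cr (t a) (t b)) u = 0.
  case: a b => [|[|[|//]]] [|[|[|//]]] _ _ /=.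
  - by rewrite (crossxx H) (dot0l H).
  - exact: ru.
  - by rewrite prE (dotNl H) qu oppr0.
  - by rewrite qpE (dotNl H) ru oppr0.
  - by rewrite (crossxx H) (dot0l H).
  - by rewrite qrE.
  - by rewrite rpE.
  - by rewrite rqE (dotNl H) pu oppr0.
  - by rewrite (crossxx H) (dot0l H).
have rowP (i : 'I_7) : [\/ (i < 3)%N /\ row i adapted_basis = t i,
    (i = 3 :> nat) /\ row i adapted_basis = u
  | exists2 a, i = a.+4 :> nat & (a < 3)%N /\ row i adapted_basis = cr (t a) u].
  rewrite rowK; case: i => -[|[|[|[|[|[|[|//]]]]]]] /= _.
  - by constructor 1.
  - by constructor 1.
  - by constructor 1.
  - by constructor 2.
  - by constructor 3; exists 0%N.
  - by constructor 3; exists 1%N.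
  - by constructor 3; exists 2%N.
move=> i j; rewrite -(inj_eq val_inj) /=.
have [[i3 ->]|[-> ->]|[a -> [a3 ->]]] := rowP i;
have [[j3 ->]|[-> ->]|[b -> [b3 ->]]] := rowP j.
- exact: tt.
- by rewrite tu // ltn_eqF.
- by rewrite sh' ttu // oppr0 ltn_eqF // (ltn_trans i3).
- by rewrite gC tu // gtn_eqF.
- exact: uu.
- exact: dot_crossr H _ _.
- by rewrite sh ttu // oppr0 gtn_eqF // (ltn_trans j3).
- by rewrite gC (dot_crossr H).
- by rewrite iso ?tu ?tt.
Qed.

Lemma adapted_basis_coassociative (i j k : 'I_7) :
  (3 < i)%N -> (3 < j)%N -> (3 < k)%N ->
  phi (row i adapted_basis) (row j adapted_basis) (row k adapted_basis) = 0.
Proof.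
have := coassociative_plane H pq pu qu ru.
rewrite !rowK; set a := cr p u; set b := cr q u; set c := cr (cr p q) u => abc.
have alt := phi_alternating H.
have swl := alternating_swapl (phi_trilinear H) alt.
have swr := alternating_swapr (phi_trilinear H) alt.
have alt12 x y : phi x x y = 0 by have [] := alt x y.
have alt23 x y : phi x y y = 0 by have [] := alt x y.
have alt13 x y : phi x y x = 0 by have [] := alt x y.
case: i => [[|[|[|[|[|[|[|//]]]]]]] ?] // _;
case: j => [[|[|[|[|[|[|[|//]]]]]]] ?] // _;
case: k => [[|[|[|[|[|[|[|//]]]]]]] ?] // _ /=; rewrite ?alt12 ?alt23 ?alt13 //.
- by rewrite swr abc oppr0.
- by rewrite swl abc oppr0.
- by rewrite swr swl abc !oppr0.
- by rewrite swl swr abc !oppr0.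
- by rewrite swl swr swl abc !oppr0.
Qed.

(** Evaluate the star in the adapted basis.  In each term of the sum either an
index lies among the first four rows, and the volume has a repeated vector, or
all three lie in the coassociative block, where phi vanishes.  The permutation
[s] only serves to make the basis positive. *)
Lemma hodge_star_associative_plane (psi : V -> V -> V -> V -> R) :
  (exists B, g2_frame phi B) ->
  hodge_star3 g (g2_positive phi) phi psi -> psi p q (cr p q) u = 0.
Proof.
move=> [B0 frB0] star; have ortB := adapted_basis_orthonormal.
have [s posB] := positive_row_perm frB0 ortB.
have rowE i : row i (row_perm s adapted_basis) = row (s i) adapted_basis.
  by rewrite row_permEsub row_rowsub.
rewrite (star _ (orthonormal_row_perm s ortB) posB).
rewrite big1 ?mulr0 // => i _; rewrite big1 // => j _; rewrite big1 // => k _.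
rewrite !rowE; set W := volume _ _.
have tail (m : 'I_7) : (m <= 3)%N -> exists2 a : 'I_7, (2 < a)%N &
    row m adapted_basis = [:: row (s i) adapted_basis; row (s j) adapted_basis;
      row (s k) adapted_basis; p; q; cr p q; u]`_a.
  rewrite rowK; case: m => -[|[|[|[|//]]]] /= _ _.
  - by exists 3.
  - by exists 4.
  - by exists 5.
  - by exists 6.
have [/tail[a a2 E]|i3] := leqP (s i) 3.
  rewrite /W (@volume_repeated _ _ 0 a) ?mulr0 //.
  by rewrite -(inj_eq val_inj) /= ltn_eqF // (ltn_trans _ a2).
have [/tail[a a2 E]|j3] := leqP (s j) 3.
  rewrite /W (@volume_repeated _ _ 1 a) ?mulr0 //.
  by rewrite -(inj_eq val_inj) /= ltn_eqF // (ltn_trans _ a2).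
have [/tail[a a2 E]|k3] := leqP (s k) 3.
  rewrite /W (@volume_repeated _ _ 2 a) ?mulr0 //.
  by rewrite -(inj_eq val_inj) /= ltn_eqF.
by rewrite adapted_basis_coassociative ?mul0r.
Qed.

End VolumeAndStar.

(** * The cross product of a G2 frame *)

Section G2FrameAlgebra.
Variable R : realType.
Local Notation V := 'rV[R]_7.

Definition wedge2 (i j : nat) (x y : V) : R :=
  dual_basis i x * dual_basis j y - dual_basis j x * dual_basis i y.

(** The cross product of R^7, obtained by raising the last index of [phi0]. *)
Definition cross0 (a b : V) : V := \row_(i < 7)
  [:: wedge2 2 3 a b + wedge2 4 5 a b + wedge2 6 7 a b;
      wedge2 3 1 a b + wedge2 4 6 a b + wedge2 7 5 a b;
      wedge2 1 2 a b + wedge2 7 4 a b + wedge2 6 5 a b;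
      wedge2 5 1 a b + wedge2 6 2 a b + wedge2 3 7 a b;
      wedge2 1 4 a b + wedge2 2 7 a b + wedge2 3 6 a b;
      wedge2 7 1 a b + wedge2 2 4 a b + wedge2 5 3 a b;
      wedge2 1 6 a b + wedge2 5 2 a b + wedge2 4 3 a b]`_i.

Lemma sum_dual_basis (a b : V) : \sum_i a 0 i * b 0 i =
  let e i := dual_basis i a * dual_basis i b in
  e 1 + e 2 + e 3 + e 4 + e 5 + e 6 + e 7.
Proof.
rewrite !big_ord_recl big_ord0 addr0 !addrA /dual_basis /=.
by do 6?[congr (_ + _)]; congr (a 0 _ * b 0 _); apply: val_inj;
  rewrite /= inordK.
Qed.

Lemma dual_basis_cross0 (a b : V) (i : nat) : (i < 7)%N ->
  dual_basis i.+1 (cross0 a b) = cross0 a b 0 (inord i).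
Proof. by []. Qed.

Lemma phi0_cross0 (a b c : V) : \sum_i cross0 a b 0 i * c 0 i = phi0 a b c.
Proof.
rewrite sum_dual_basis /= !dual_basis_cross0 // !mxE !inordK //=.
by rewrite /wedge2 /phi0 /wedge3; ring.
Qed.

(** The Lagrange identity of the octonions, a polynomial identity in the
fourteen coordinates. *)
Lemma cross0_norm (a b : V) :
  \sum_i cross0 a b 0 i * cross0 a b 0 i =
    (\sum_i a 0 i * a 0 i) * (\sum_i b 0 i * b 0 i)
    - (\sum_i a 0 i * b 0 i) ^+ 2.
Proof.
rewrite !sum_dual_basis /= !dual_basis_cross0 // !mxE !inordK //=.
by rewrite /wedge2; ring.
Qed.

Lemma g2_frame_cross_algebra (phi : V -> V -> V -> R) (g : V -> V -> R)
    (cr : V -> V -> V) (B : 'M[R]_7) :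
  trilinear phi -> Defs.alternating phi -> (forall x, scalar (g x)) ->
  (forall x y, g x y = g y x) -> (forall x, x != 0 -> 0 < g x x) ->
  cross_product phi g cr -> g2_inner_product phi g -> g2_frame phi B ->
  cross_algebra phi g cr.
Proof.
move=> phiT phiA gr gC g0 crE inner frB; split => // x y.
have [Bu phiB] := frB; have gB := inner _ frB.
have inB (z : V) : exists a, z = a *m B by exists (z *m invmx B); rewrite mulmxKV.
have [a ->] := inB x; have [b ->] := inB y.
suff -> : cr (a *m B) (b *m B) = cross0 a b *m B by rewrite !gB cross0_norm.
(* The difference d of the two sides is orthogonal to every vector, in
   particular to itself. *)
apply/eqP; rewrite -subr_eq0; apply/negPn/negP => /g0.
set d := _ - _; have [c dE] := inB d.
have gd z : g d z = g (cr (a *m B) (b *m B)) z - g (cross0 a b *m B) z.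
  by rewrite !(gC _ z) (scalarD (gr z)) (scalarN (gr z)).
by rewrite gd dE -crE phiB gB phi0_cross0 subrr ltxx.
Qed.

End G2FrameAlgebra.

(** * The obstruction at a point *)

Section PointwiseObstruction.
Variable R : realType.
Local Notation V := 'rV[R]_7.
Variables (phi : V -> V -> V -> R) (g : V -> V -> R) (cr : V -> V -> V).
Hypothesis H : cross_algebra phi g cr.

(** Three linear equations in seven unknowns have a nonzero solution. *)
Lemma unit_vector_orthogonal_to3 (a b c : V) :
  exists q, [/\ g q q = 1, g q a = 0, g q b = 0 & g q c = 0].
Proof.
pose A := \matrix_(i < 7, j < 3) g (delta_mx 0 i) [:: a; b; c]`_j.
have gA (x : V) (j : 'I_3) : (x *m A) 0 j = g x [:: a; b; c]`_j.
  rewrite mxE {2}(row_sum_delta x) (dotC H) (scalar_sum (dot_scalar H _)).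
  by apply: eq_bigr => i _; rewrite (dotZr H) mxE (dotC H).
have w0 : nz_row (kermx A) != 0.
  rewrite nz_row_eq0 kermx_eq0 /row_free; apply/negP => /eqP rkA.
  by have := rank_leq_col A; rewrite rkA.
have wA : nz_row (kermx A) *m A = 0 by apply/sub_kermxP; exact: nz_row_sub.
move: (nz_row _) w0 wA => w w0 wA; have gw := dot_gt0 H w0.
exists ((Num.sqrt (g w w))^-1 *: w); split.
- rewrite (dotZr H) (dotZl H) mulrA -invfM -expr2 sqr_sqrtr ?ltW //.
  by rewrite mulVf // lt0r_neq0.
- by rewrite (dotZl H) -(gA w 0) wA mxE mulr0.
- by rewrite (dotZl H) -(gA w 1) wA mxE mulr0.
- by rewrite (dotZl H) -(gA w 2) wA mxE mulr0.
Qed.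

(** Here [beta] stands for nabla_xi phi and [v] for nabla_xi xi.  If q is a unit
vector orthogonal to xi, v and xi x v, and n is any vector orthogonal to q, then
q x (n x q) = n, so beta(q, n x q, n) = 0.  Taking n = xi, v and xi + v, this
polarizes to beta(q, xi x q, v) = - beta(q, v x q, xi), and the right-hand side
is phi(v, q, v x q) = |v|^2.  The left-hand side is a multiple of the star of
phi on the associative plane of xi and q, hence zero. *)
Lemma nearly_parallel_obstruction (psi : V -> V -> V -> V -> R) (k : R)
    (beta : V -> V -> V -> R) (xi v : V) :
  (exists B, g2_frame phi B) ->
  hodge_star3 g (g2_positive phi) phi psi ->
  trilinear beta -> Defs.alternating beta ->
  (forall y z, beta y z (cr y z) = 0) ->
  g xi xi = 1 -> g xi v = 0 ->
  (forall y z, g xi y = 0 -> g xi z = 0 -> beta xi y z = - phi v y z) ->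
  (forall x y z, g xi x = 0 -> g xi y = 0 -> g xi z = 0 ->
    beta x y z = k * psi xi x y z) ->
  v = 0.
Proof.
move=> frB star betaT betaA beta_cross xi1 xiv beta_xi beta_hor.
have [//|v0] := eqVneq v 0; have gv := dot_gt0 H v0.
have gC := dotC H.
have [q [qq qxi qv qxv]] := unit_vector_orthogonal_to3 xi v (cr xi v).
have xiq : g xi q = 0 by rewrite gC.
have vq : g v q = 0 by rewrite gC.
have vq_xi : g xi (cr v q) = 0.
  by rewrite gC (dot_crossC H) (crossC H) (dotNl H) gC qxv !oppr0.
have beta_nq n : g n q = 0 -> beta q (cr n q) n = 0.
  move=> nq; have := beta_cross q (cr n q).
  rewrite (crossC H n) (crossNr H) (cross_crossl H) gC nq qq scale0r scale1r.
  by rewrite sub0r opprK.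
have beta_v : beta q (cr xi q) v = g v v.
  have := beta_nq (xi + v).
  rewrite (dotDl H) xiq vq addr0 => /(_ erefl).
  rewrite (crossDl H) (trilinearDm betaT) !(trilinearDr betaT).
  rewrite !beta_nq // add0r addr0.
  rewrite -[beta q (cr v q) xi](alternating_rot betaT betaA).
  rewrite beta_xi // -(dot_cross H) (dot_cross_cross H) qq vq.
  by rewrite expr0n subr0 mulr1 => /eqP; rewrite subr_eq0 => /eqP.
set s := Num.sqrt (g v v).
have s0 : s != 0 by rewrite lt0r_neq0 // sqrtr_gt0.
pose u := s^-1 *: v.
have uu : g u u = 1.
  by rewrite (dotZr H) (dotZl H) mulrA -invfM -expr2 sqr_sqrtr ?ltW // mulVf
    ?lt0r_neq0.
have xiu : g xi u = 0 by rewrite (dotZr H) xiv mulr0.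
have qu : g q u = 0 by rewrite (dotZr H) qv mulr0.
have ru : g (cr xi q) u = 0.
  by rewrite (dotZr H) (dot_crossC H) gC qxv oppr0 mulr0.
have psi0 : psi xi q (cr xi q) u = 0.
  by apply: (hodge_star_associative_plane H); rewrite // gC.
have : beta q (cr xi q) u = 0.
  by rewrite beta_hor ?psi0 ?mulr0 // (dot_crossl H).
have [_ _ L] := betaT; rewrite (scalarZ (L _ _)) beta_v => /eqP.
by rewrite mulf_eq0 invr_eq0 (negbTE s0) (gt_eqF gv).
Qed.

End PointwiseObstruction.

(** * Directional derivatives of families of forms *)

Section DirectionalDerivatives.
Variables (R : realType) (n : nat).
Local Notation V := 'rV[R]_n.

Lemma derive_near0 (h : V -> R) (u x : V) :
  (\forall w \near u, h w = 0) -> 'D_x h u = 0.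
Proof. by move=> h0; rewrite (near_eq_derive (g := cst 0)) ?derive_cst. Qed.

Lemma derive_scalar (T : V -> V -> R) (u x : V) :
  (\forall w \near u, scalar (T w)) -> (forall y, derivable (T^~ y) u x) ->
  scalar (fun y => 'D_x (T^~ y) u).
Proof.
move=> linT dT a y z.
rewrite (_ : 'D_x (T^~ (a *: y + z)) u =
             'D_x (a *: (T^~ y) + T^~ z) u); last first.
  apply: near_eq_derive; near=> w; have linw : scalar (T w) by near: w.
  by rewrite linw.
by rewrite deriveD ?deriveZ //; exact: derivableZ.
Unshelve. all: by end_near. Qed.

(** The Leibniz rule for the pairing of a family of linear forms with a vector
field, by expanding the field in coordinates. *)
Lemma is_derive_scalar_app (T : V -> V -> R) (X : V -> V) (u x : V) :
  (\forall w \near u, scalar (T w)) -> (forall y, derivable (T^~ y) u x) ->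
  derivable X u x ->
  is_derive u x (fun w => T w (X w)) ('D_x (T^~ (X u)) u + T u ('D_x X u)).
Proof.
move=> linT dT dX.
have dXi (i : 'I_n) : derivable (fun w => X w 0 i) u x.
  by move/derivable_mxP: dX => /(_ 0 i).
have lin_u := nbhs_singleton linT.
pose F := \sum_(i < n) ((fun w => X w 0 i) * T^~ (delta_mx 0 i)).
apply: (@near_eq_is_derive _ _ _ F).
  near=> w; have linw : scalar (T w) by near: w.
  rewrite {1}(row_sum_delta (X w)) (scalar_sum linw) /F fct_sumE.
  by apply: eq_bigr => i _; rewrite (scalarZ linw).
have -> : 'D_x (T^~ (X u)) u + T u ('D_x X u) = \sum_(i < n)
    (X u 0 i *: 'D_x (T^~ (delta_mx 0 i)) u
     + T u (delta_mx 0 i) *: 'D_x (fun w => X w 0 i) u).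
  rewrite big_split /=; congr (_ + _).
    have linD := derive_scalar linT dT.
    rewrite {1}(row_sum_delta (X u)) (scalar_sum linD).
    by apply: eq_bigr => i _; rewrite (scalarZ linD).
  rewrite (row_sum_delta ('D_x X u)) (scalar_sum lin_u).
  apply: eq_bigr => i _; rewrite (scalarZ lin_u) derive_mx // mxE.
  exact: mulrC.
apply: is_derive_sum => i; apply: is_deriveM; exact: derivableP.
Unshelve. all: by end_near. Qed.

Lemma derive_eq0_local_min (h : V -> R) (u x : V) :
  (\forall w \near u, derivable h w x) -> (\forall w \near u, h u <= h w) ->
  'D_x h u = 0.
Proof.
move=> dh minh.
have line : continuous (fun t : R => t *: x + u).
  by move=> t; apply: cvgD; [exact: scalel_continuous|exact: cvg_cst].
have near_line (P : set V) : (\forall w \near u, P w) ->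
    \forall t \near (0 : R), P (t *: x + u).
  by move=> Pu; have := line 0; rewrite /continuous_at scale0r add0r; apply.
have [e /= e0 He] : \forall t \near (0 : R),
    derivable h (t *: x + u) x /\ h u <= h (t *: x + u).
  near=> t; split; near: t.
    exact: (near_line (fun w => derivable h w x)).
  exact: (near_line (fun w => h u <= h w)).
pose f t := h (t *: x + u).
have f0 : 'D_x h u = 'D_1 f 0.
  rewrite /derive; set g1 := fun t => t^-1 *: _; set g2 := fun t => t^-1 *: _.
  suff -> : g1 = g2 by []; rewrite funeqE /g1 /g2 => t /=.
  by rewrite /f /= addr0 scale0r add0r [_%:A]mulr1.
have inE (t : R) : t \in `]- e, e[ -> ball_ Num.norm 0 e t.
  by rewrite in_itv /= sub0r normrN ltr_norml.
rewrite f0; apply: derive_val; apply: (@derive1_at_min _ f (- e) e).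
- by rewrite ltW // gtrN.
- move=> t /inE/He [+ _]; move/derivable1P.
  move=> dt; apply/derivable1P.
  suff -> : (fun s : R => f (s *: 1 + t)) =
            (fun s => h (s *: x + (t *: x + u))) by [].
  by apply/funext => s; rewrite /f [s *: 1]mulr1 addrA -scalerDl.
- by rewrite in_itv /= oppr_lt0 e0.
- by move=> t /inE/He [_]; rewrite /f scale0r add0r.
Unshelve. all: by end_near. Qed.

(** The function (A B - C^2) D - P^2 has a minimum at u, so its derivative
vanishes there.  In the use below it is the Cauchy-Schwarz gap
|y x z|^2 |W|^2 - <y x z, W>^2, for a vector W constant in the chart that
agrees with y x z at u.  Differentiating this gap avoids differentiating the
cross product itself: only the metric and the 3-form occur in it. *)
Lemma derive_cauchy_schwarz_gap (A B C D P : V -> R) (u x : V) :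
  (\forall w \near u, differentiable A w) ->
  (\forall w \near u, differentiable B w) ->
  (\forall w \near u, differentiable C w) ->
  (\forall w \near u, differentiable D w) ->
  (\forall w \near u, differentiable P w) ->
  let N := A u * B u - C u * C u in
  N * D u - P u * P u = 0 ->
  (\forall w \near u, 0 <= (A w * B w - C w * C w) * D w - P w * P w) ->
  D u * ('D_x A u * B u + A u * 'D_x B u - (C u * 'D_x C u) *+ 2) + N * 'D_x D u
    = (P u * 'D_x P u) *+ 2.
Proof.
move=> dA dB dC dD dP N gap0 gap.
pose h := (A * B - C * C) * D - P * P.
have : 'D_x h u = 0.
  apply: derive_eq0_local_min.
    near=> w; apply: diff_derivable.
    have dAw : differentiable A w by near: w.
    have dBw : differentiable B w by near: w.
    have dCw : differentiable C w by near: w.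
    have dDw : differentiable D w by near: w.
    have dPw : differentiable P w by near: w.
    apply: differentiableB; apply: differentiableM => //.
    by apply: differentiableB; exact: differentiableM.
  by near=> w; rewrite [h u]gap0; near: w.
have d (f : V -> R) : (\forall w \near u, differentiable f w) ->
    is_derive u x f ('D_x f u).
  by move=> df; apply/derivableP/diff_derivable/(nbhs_singleton df).
have iA := d A dA; have iB := d B dB; have iC := d C dC; have iD := d D dD.
have iP := d P dP.
rewrite derive_val /GRing.scale /= => E.
apply/eqP; rewrite -subr_eq0; apply/eqP; rewrite -[RHS]E /N !fctE; ring.
Unshelve. all: by end_near. Qed.

End DirectionalDerivatives.

(** * The covariant derivatives of phi, Phi and xi in a chart *)

Section CovariantDerivativeOf3Form.
Variables (R : realType) (n : nat).
Local Notation V := 'rV[R]_n.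
Variables (phi : V -> V -> V -> V -> R) (g : V -> V -> V -> R).
Variables (cr : V -> V -> V -> V) (Gam : V -> V -> V) (u : V).

Definition nabla_form3 (x y z t : V) : R :=
  'D_x (fun w => phi w y z t) u
  - phi u (Gam x y) z t - phi u y (Gam x z) t - phi u y z (Gam x t).

Hypothesis cross_near : \forall w \near u, cross_algebra (phi w) (g w) (cr w).
Hypothesis dphi : forall y z t, \forall w \near u,
  differentiable (fun w => phi w y z t) w.
Hypothesis dg : forall y z, \forall w \near u,
  differentiable (fun w => g w y z) w.
Hypothesis Gam_linear : forall x, linear (Gam x).
Hypothesis Gam_sym : forall x y, Gam x y = Gam y x.
Hypothesis nabla_g : forall x y z,
  'D_x (fun w => g w y z) u = g u (Gam x y) z + g u y (Gam x z).

Let cross_u : cross_algebra (phi u) (g u) (cr u) := nbhs_singleton cross_near.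
Let phiT := phi_trilinear cross_u.
Let phiA := phi_alternating cross_u.

Let drv_phi x y z t : derivable (fun w => phi w y z t) u x.
Proof. exact: diff_derivable (nbhs_singleton (dphi y z t)). Qed.

Let drv_g x y z : derivable (fun w => g w y z) u x.
Proof. exact: diff_derivable (nbhs_singleton (dg y z)). Qed.

Lemma nabla_form3_trilinear x : trilinear (nabla_form3 x).
Proof.
have [L1 L2 L3] := phiT.
split=> [z t|y t|y z] a y1 y2; rewrite /nabla_form3.
- have D : scalar (fun y => 'D_x (fun w => phi w y z t) u).
    apply: (@derive_scalar _ _ (fun w y => phi w y z t)) => [|y].
      near=> w; have Hw : cross_algebra (phi w) (g w) (cr w) by near: w.
      by have [L _ _] := phi_trilinear Hw.
    exact: drv_phi.
  by rewrite D Gam_linear !L1; ring.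
- have D : scalar (fun z => 'D_x (fun w => phi w y z t) u).
    apply: (@derive_scalar _ _ (fun w z => phi w y z t)) => [|z].
      near=> w; have Hw : cross_algebra (phi w) (g w) (cr w) by near: w.
      by have [_ L _] := phi_trilinear Hw.
    exact: drv_phi.
  by rewrite D Gam_linear !L2; ring.
- have D : scalar (fun t => 'D_x (fun w => phi w y z t) u).
    apply: (@derive_scalar _ _ (fun w t => phi w y z t)) => [|t].
      near=> w; have Hw : cross_algebra (phi w) (g w) (cr w) by near: w.
      by have [_ _ L] := phi_trilinear Hw.
    exact: drv_phi.
  by rewrite D Gam_linear !L3; ring.
Unshelve. all: by end_near. Qed.

Lemma nabla_form3_alternating x : Defs.alternating (nabla_form3 x).
Proof.
have swl := alternating_swapl phiT phiA.
have swr := alternating_swapr phiT phiA.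
move=> y z; have [a1 a2 a3] := phiA y z.
split; rewrite /nabla_form3 derive_near0 ?sub0r.
- have [-> _ _] := phiA y (Gam x z).
  by rewrite subr0 (swl y) opprK addNr.
- near=> w; have Hw : cross_algebra (phi w) (g w) (cr w) by near: w.
  by have [] := phi_alternating Hw y z.
- have [_ -> _] := phiA (Gam x y) z.
  by rewrite oppr0 sub0r (swr y z) opprK addNr.
- near=> w; have Hw : cross_algebra (phi w) (g w) (cr w) by near: w.
  by have [] := phi_alternating Hw y z.
- have [_ _ ->] := phiA y (Gam x z).
  rewrite subr0 (swl y z) (swr z y) (swl z) !opprK.
  by rewrite addNr.
- near=> w; have Hw : cross_algebra (phi w) (g w) (cr w) by near: w.
  by have [] := phi_alternating Hw y z.
Unshelve. all: by end_near. Qed.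

(** Differentiating |y x z|^2 = |y|^2 |z|^2 - <y, z>^2 with a parallel metric.
The terms with Christoffel symbols match by polarizing the same identity. *)
Lemma nabla_form3_cross x y z : nabla_form3 x y z (cr u y z) = 0.
Proof.
have [_ _ L3] := nabla_form3_trilinear x.
set W := cr u y z.
have [->|W0] := eqVneq W 0; first exact: scalar0 (L3 y z).
have gW := dot_gt0 cross_u W0.
have phiW : phi u y z W = g u W W by rewrite -(dot_cross cross_u).
have gWE : g u W W = g u y y * g u z z - g u y z * g u y z.
  by rewrite (dot_cross_cross cross_u) expr2.
have := @derive_cauchy_schwarz_gap _ _ (fun w => g w y y) (fun w => g w z z)
  (fun w => g w y z) (fun w => g w W W) (fun w => phi w y z W) u x
  (dg y y) (dg z z) (dg y z) (dg W W) (dphi y z W).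
rewrite /= phiW -gWE !nabla_g => min0.
have {min0} E := min0 (subrr _).
have gap : \forall w \near u, 0 <=
    (g w y y * g w z z - g w y z * g w y z) * g w W W - phi w y z W * phi w y z W.
  near=> w; have Hw : cross_algebra (phi w) (g w) (cr w) by near: w.
  rewrite -(dot_cross Hw) -expr2 -(expr2 (g w (cr w y z) W)).
  by rewrite -(dot_cross_cross Hw) subr_ge0 (cauchy_schwarz Hw).
have {}E := E gap; apply: (mulfI (lt0r_neq0 gW)).
have gC := dotC cross_u.
have phi1 : phi u (Gam x y) z W =
    g u z z * g u (Gam x y) y - g u (Gam x y) z * g u y z.
  rewrite -(dot_cross cross_u) /W (crossC cross_u _ z) (crossC cross_u y).
  rewrite (dotNl cross_u) (dotNr cross_u) opprK (dot_cross_cross2 cross_u).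
  by rewrite !(gC z).
have phi2 : phi u y (Gam x z) W =
    g u y y * g u (Gam x z) z - g u y (Gam x z) * g u y z.
  by rewrite -(dot_cross cross_u) (dot_cross_cross2 cross_u).
have phi3 : phi u y z (Gam x W) = g u W (Gam x W) by rewrite -(dot_cross cross_u).
rewrite /nabla_form3 phi1 phi2 phi3.
move: E; rewrite (gC (Gam x W)) (gC y (Gam x y)) (gC z (Gam x z)) => E.
lra.
Unshelve. all: by end_near. Qed.

(** The Christoffel terms cancel in pairs by the symmetry of [Gam]. *)
Lemma exterior_derivative_nabla_form3 x y z t :
  'D_x (fun w => phi w y z t) u - 'D_y (fun w => phi w x z t) u
  + 'D_z (fun w => phi w x y t) u - 'D_t (fun w => phi w x y z) u =
  nabla_form3 x y z t - nabla_form3 y x z t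
  + nabla_form3 z x y t - nabla_form3 t x y z.
Proof.
have swl := alternating_swapl phiT phiA.
have rot a b c : phi u a b c = phi u c a b.
  by rewrite -(alternating_rot phiT phiA).
rewrite /nabla_form3 (Gam_sym y x) (Gam_sym z x) (Gam_sym z y) (Gam_sym t x)
  (Gam_sym t y) (Gam_sym t z).
rewrite (swl y (Gam x z) t) (rot y z (Gam x t)) (swl x (Gam y z) t)
  (rot x z (Gam y t)) (rot x y (Gam z t)) (swl x (Gam y t) z).
lra.
Qed.

Variable xi : V -> V.
Hypothesis dxi : differentiable xi u.

Definition nabla_vec (x : V) : V := 'D_x xi u + Gam x (xi u).

Let drv_xi x : derivable xi u x := diff_derivable dxi.

(** As Phi(y, z) = phi(xi, z, y), this is the Leibniz rule for the contraction
of phi with xi. *)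
Lemma nabla_fundamental_form x y z :
  'D_x (fun w => g w y (cr w (xi w) z)) u - g u (Gam x y) (cr u (xi u) z)
    - g u y (cr u (xi u) (Gam x z)) =
  nabla_form3 x (xi u) z y + phi u (nabla_vec x) z y.
Proof.
have [L1 _ _] := phiT.
have -> : 'D_x (fun w => g w y (cr w (xi w) z)) u =
    'D_x (fun w => phi w (xi w) z y) u.
  apply: near_eq_derive; near=> w.
  have Hw : cross_algebra (phi w) (g w) (cr w) by near: w.
  by rewrite (dotC Hw) (dot_cross Hw).
have D : is_derive u x (fun w => phi w (xi w) z y)
    ('D_x (fun w => phi w (xi u) z y) u + phi u ('D_x xi u) z y).
  apply: (@is_derive_scalar_app _ _ (fun w s => phi w s z y)) => //.
  near=> w; have Hw : cross_algebra (phi w) (g w) (cr w) by near: w.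
  by have [L _ _] := phi_trilinear Hw.
rewrite derive_val !(dotC cross_u _ (cr u (xi u) _)) !(dot_cross cross_u).
by rewrite /nabla_form3 /nabla_vec (scalarD (L1 z y)); ring.
Unshelve. all: by end_near. Qed.

Hypothesis xi_unit : \forall w \near u, g w (xi w) (xi w) = 1.

(** The derivative of g(xi, xi) = 1. *)
Lemma nabla_vec_orthogonal x : g u (xi u) (nabla_vec x) = 0.
Proof.
have gC := dotC cross_u.
have lin_g : \forall w \near u, forall y, scalar (g w y).
  near=> w; have Hw : cross_algebra (phi w) (g w) (cr w) by near: w.
  exact: dot_scalar Hw.
have lin_g' y : \forall w \near u, scalar (g w ^~ y).
  near=> w; have Hw : cross_algebra (phi w) (g w) (cr w) by near: w.
  by move=> a s t; rewrite (dotDl Hw) (dotZl Hw).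
have D y : is_derive u x (fun w => g w (xi w) y)
    ('D_x (fun w => g w (xi u) y) u + g u ('D_x xi u) y).
  by apply: (@is_derive_scalar_app _ _ (fun w s => g w s y)) => // s; exact: drv_g.
have : is_derive u x (fun w => g w (xi w) (xi w))
    ('D_x (fun w => g w (xi w) (xi u)) u + g u (xi u) ('D_x xi u)).
  apply: (@is_derive_scalar_app _ _ (fun w s => g w (xi w) s)) => //.
  by near=> w; have Hw : forall y, scalar (g w y) by near: w.
move=> DD; have : 'D_x (fun w => g w (xi w) (xi w)) u = 0.
  by rewrite (near_eq_derive (g := cst (1 : R))) ?derive_cst.
rewrite derive_val derive_val nabla_g.
rewrite /nabla_vec (dotDr cross_u) (gC _ (xi u)) (gC _ (xi u)).
lra.
Unshelve. all: by end_near. Qed.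

End CovariantDerivativeOf3Form.

(** * Nearly parallel G2 structures *)

Theorem theorem2 (R : realType) (M : topologicalType)
    (hausdorff_M : hausdorff_space M) (countable_M : @second_countable M)
    (S : smooth_atlas R 7 M)
    (phi : S -> 'rV[R]_7 -> 'rV[R]_7 -> 'rV[R]_7 -> 'rV[R]_7 -> R)
    (g : S -> 'rV[R]_7 -> 'rV[R]_7 -> 'rV[R]_7 -> R)
    (cross nabla : S -> 'rV[R]_7 -> 'rV[R]_7 -> 'rV[R]_7 -> 'rV[R]_7)
    (xi : S -> 'rV[R]_7 -> 'rV[R]_7)
    (phi_g2 : g2_structure phi)
    (phi_metric : g2_metric phi g)
    (phi_cross : forall c u, chart_image c u ->
       cross_product (phi c u) (g c u) (cross c u))
    (nabla_lc : levi_civita g nabla)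
    (phi_np : nearly_parallel phi g)
    (xi_field : vector_field xi)
    (xi_unit : forall c u, chart_image c u -> g c u (xi c u) (xi c u) = 1)
    (nabla_xi_xi : exists c u,
       chart_image c u /\ nabla_vector nabla xi c u (xi c u) != 0) :
  let J := induced_endomorphism cross xi in
  let eta := induced_1form g xi in
  let nabla_Phi := nabla_tensor2 nabla (fundamental_2form g J) in
  [/\ ~ belongs_to (@classD1 R) J xi eta nabla_Phi,
      ~ belongs_to (@classD2 R) J xi eta nabla_Phi
    & ~ belongs_to (@classC12 R) J xi eta nabla_Phi].
Proof.
move=> J eta nabla_Phi.
have [[phi_form phi_smooth _] phi_frame] := phi_g2.
have [[[g_bilin g_smooth _] g_pos] g_inner] := phi_metric.
have [[nabla_lin _ _] nabla_sym nabla_g] := nabla_lc.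
have cross_alg c u : chart_image c u ->
    cross_algebra (phi c u) (g c u) (cross c u).
  move=> Uu; have [B frB] := phi_frame _ _ Uu.
  have [phiT phiA] := phi_form _ _ Uu.
  have [gC g0] := g_pos _ _ Uu; have [_ gr] := g_bilin _ _ Uu.
  exact: (g2_frame_cross_algebra phiT phiA gr gC g0 (phi_cross _ _ Uu)
    (g_inner _ _ Uu) frB).
have [c [u [Uu v0]]] := nabla_xi_xi.
have near_u : \forall w \near u, chart_image c w.
  by apply: open_nbhs_nbhs; split => //; exact: image_open.
have cross_near : \forall w \near u,
    cross_algebra (phi c w) (g c w) (cross c w).
  by near=> w; apply: cross_alg; near: w.
have dphi y z t : \forall w \near u, differentiable (fun w => phi c w y z t) w.
  by have [d _] := phi_smooth c y z t 1%N; near=> w; apply: d; near: w.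
have dg y z : \forall w \near u, differentiable (fun w => g c w y z) w.
  by have [d _] := g_smooth c y z 1%N; near=> w; apply: d; near: w.
have dxi : differentiable (xi c) u.
  by have [xi_smooth _] := xi_field; have [d _] := xi_smooth c 1%N; exact: d.
have Gam_lin x : linear (nabla c u x) by have [_] := nabla_lin _ _ Uu.
have Gam_sym := nabla_sym _ _ Uu.
have g_par x y z : 'D_x (fun w => g c w y z) u =
    g c u (nabla c u x y) z + g c u y (nabla c u x z).
  have /eqP := nabla_g _ _ Uu x y z.
  by rewrite /nabla_tensor2 -addrA -opprD subr_eq0 => /eqP.
have xi_unit_near : \forall w \near u, g c w (xi c w) (xi c w) = 1.
  by near=> w; apply: xi_unit; near: w.
have alg := cross_alg _ _ Uu.
pose b := nabla_form3 (phi c) (nabla c u) u.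
pose N := nabla_vector nabla xi c u.
pose k := xi c u.
have bT x : trilinear (b x) := nabla_form3_trilinear cross_near dphi Gam_lin x.
have bA x : Defs.alternating (b x)
  := nabla_form3_alternating (nabla c u) cross_near x.
have PhiE x y z : nabla_Phi c u x y z = b x k z y + phi c u (N x) z y.
  exact (nabla_fundamental_form (nabla c u) cross_near dphi dxi x y z).
have N_perp x : g c u k (N x) = 0.
  exact (nabla_vec_orthogonal cross_near dg g_par dxi xi_unit_near x).
have k1 : g c u k k = 1 := xi_unit _ _ Uu.
(* nabla_x phi drops out of (nabla_x Phi)(xi, z), because it is alternating. *)
have N0 x : (forall z, nabla_Phi c u x k z = 0) -> N x = 0.
  move=> Nx; apply: (orthogonal_cross_eq0 alg k1 (N_perp x)) => z.
  by have := Nx z; rewrite PhiE; have [_ _ ->] := bA x k z; rewrite add0r.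
have vN0 : N k != 0 := v0.
split=> /(_ c u Uu) [[_ skew] D].
- by move/eqP: vN0; apply; apply: N0 => z; have [] := D k z.
- move/eqP: vN0; apply; apply: N0 => z.
  have kkk : nabla_Phi c u k k k = 0 by have [+ _] := skew k k k; lra.
  have := D k k z; rewrite kkk mulr0 addr0 /eta /induced_1form k1 mul1r.
  lra.
move/eqP: vN0; apply.
(* What is left is the class C12. *)
have eta0 x : g c u k x = 0 -> eta c u x = 0 by [].
have hor x y z : g c u k x = 0 -> nabla_Phi c u x y z = 0.
  by move=> kx; rewrite D eta0 // !mul0r addr0.
have b_hor x y z : g c u k x = 0 -> b x k y z = 0.
  move=> kx; have Nx : N x = 0 by apply: N0 => t; exact: hor.
  have := hor x z y kx; rewrite PhiE Nx.
  by have [L _ _] := phi_trilinear alg; rewrite (scalar0 (L _ _)) addr0.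
have [a /(_ c u Uu) [psi star dphiE]] := phi_np.
apply: (nearly_parallel_obstruction alg (phi_frame _ _ Uu) star (bT k) (bA k)
  _ k1 (N_perp k) _ (k := a)).
- exact (nabla_form3_cross cross_near dphi dg Gam_lin g_par k).
- move=> y z ky kz; have := D k z y.
  rewrite (eta0 y) // (eta0 z) // !(mulr0, mul0r) addr0 PhiE => /eqP.
  by rewrite addr_eq0 => /eqP.
- move=> x y z kx ky kz; rewrite -dphiE /exterior_derivative.
  rewrite (exterior_derivative_nabla_form3 cross_near Gam_sym) -/b.
  by rewrite !b_hor // !subr0 addr0.
Unshelve. all: by end_near. Qed.
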